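(* Let $d\ge 2$ and $q\geq 3$ be natural numbers, and let $U$ be a subset of the vertices of the Hamming graph $H(d,q)$ with $|U|\geq 2q^{d-1}+1$. Then the VC-dimension of $(U,n(U))$ is at least $2$.
   Context: The Hamming graph $H(d,q)$ has vertex set $\mathbb Z_q^d$, with two vertices adjacent if and only if they differ in exactly one coordinate. For a vertex $x$, $n(x)$ denotes its neighborhood, the set of vertices adjacent to $x$ (so $x\notin n(x)$), and for a set $U$ of vertices $n(U)=\{n(u):u\in U\}$. A set $W\subseteq U$ is shattered by $n(U)$ if for every $S\subseteq W$ there is $u\in U$ with $n(u)\cap W=S$. The VC-dimension of $(U,n(U))$ is the size of the largest $W\subseteq U$ that is shattered by $n(U)$. *)

(* Defs.v *)
From mathcomp Require Import all_boot all_algebra.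
Set Implicit Arguments.
Unset Strict Implicit.
Unset Printing Implicit Defensive.

(* 'Z_q has q elements only when 1 < q. *)
Definition hamming_vertex (d q : nat) : finType := {ffun 'I_d -> 'Z_q}.

Definition hamming_adj (d q : nat) : rel (hamming_vertex d q) :=
  fun x y => #|[set i | x i != y i]| == 1.

Definition neighborhood (V : finType) (adj : rel V) (x : V) : {set V} :=
  [set y | adj x y].

Definition neighborhoods (V : finType) (adj : rel V) (U : {set V}) :
    {set {set V}} :=
  [set neighborhood adj u | u in U].

Definition shattered (V : finType) (F : {set {set V}}) (W : {set V}) : bool :=
  [forall S : {set V}, (S \subset W) ==> [exists A in F, A :&: W == S]].

(* When F is empty no W is shattered and this value is 0. *)
Definition vc_dim (V : finType) (U : {set V}) (F : {set {set V}}) : nat :=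
  \max_(W : {set V} | (W \subset U) && shattered F W) #|W|.

(* Main.v *)
Require Import Defs.
From mathcomp Require Import all_boot all_algebra.

(** By pigeonhole, some line in a fixed direction contains three points of [U],
    and [U] is too large to lie on that line, so it has a point [w] off the line.
    Since [w] is adjacent to at most one point of the line, two of the three
    points, [a] and [b], are not adjacent to [w]. The pair [{a, b}] is shattered:
    the third point sees both, [b] sees only [a], [a] sees only [b], and [w]
    sees neither. *)

(** If every fiber had at most [k] points, summing over [D] would give at most [k * #|D|] points in
    [U]. Counting against [D] instead of all of [T'] matters when [f] is far from surjective. *)
Lemma exists_fiber_gt (T T' : finType) (f : T -> T') (U : {set T})
    (D : {pred T'}) (k : nat) :
  (forall x, x \in U -> f x \in D) -> k * #|D| < #|U| ->
  exists y, k < #|[set x in U | f x == y]|.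
Proof.
move=> fD ltkU; apply/existsP; apply: contraLR ltkU => /existsPn small.
rewrite -leqNgt -sum1_card (partition_big f (mem D)) //= mulnC -sum_nat_const.
apply: leq_sum => y _; have := small y; rewrite -leqNgt -sum1_card.
by under eq_bigl do rewrite inE.
Qed.

Lemma vc_dim_ge2 (V : finType) (U : {set V}) (adj : rel V) (a b u0 ua ub uab : V) :
    a \in U -> b \in U -> a != b ->
    [/\ u0 \in U, ~~ adj u0 a & ~~ adj u0 b] ->
    [/\ ua \in U, adj ua a & ~~ adj ua b] ->
    [/\ ub \in U, ~~ adj ub a & adj ub b] ->
    [/\ uab \in U, adj uab a & adj uab b] ->
  2 <= vc_dim U (neighborhoods adj U).
Proof.
move=> aU bU ab H0 Ha Hb Hab.
have <- : #|[set a; b]| = 2 by rewrite cards2 ab.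
apply: (@leq_bigmax_cond _ _ (fun W : {set V} => #|W|)); apply/andP; split.
  by apply/subsetP => x /set2P[] ->.
apply/forallP => S; apply/implyP => /subsetP sSab.
(* As [S] lies inside [[set a; b]], it is determined by whether it contains [a] and whether it
   contains [b]. *)
suff [u [uU ua_S ub_S]] : exists u, [/\ u \in U, adj u a = (a \in S)
                                       & adj u b = (b \in S)].
  apply/existsP; exists (neighborhood adj u); rewrite imset_f //=.
  apply/eqP/setP => x; rewrite !inE; apply/andP/idP.
    by case=> + /orP[] /eqP eqx; rewrite eqx ?ua_S ?ub_S.
  by move=> xS; have := sSab x xS => /set2P[] eqx; move: xS;
    rewrite eqx -?ua_S -?ub_S eqxx ?orbT.
case: (a \in S); case: (b \in S).
- by exists uab; case: Hab.
- by exists ua; case: Ha => ? ? /negbTE.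
- by exists ub; case: Hb => ? /negbTE.
- by exists u0; case: H0 => ? /negbTE ? /negbTE.
Qed.

Section Line.

Variables (d q : nat) (i0 : 'I_d).
Implicit Types x y w : hamming_vertex d q.

(* The fibers of this map are the lines in direction [i0]. *)
Definition erase_coord x : hamming_vertex d q :=
  [ffun i => if i == i0 then 0%R else x i].

Lemma erase_coordP x y :
  reflect (forall i, i != i0 -> x i = y i) (erase_coord x == erase_coord y).
Proof.
apply: (iffP eqP) => [/ffunP eqxy i ni|eqxy].
  by have := eqxy i; rewrite !ffunE (negbTE ni).
by apply/ffunP => i; rewrite !ffunE; case: eqVneq => // /eqxy.
Qed.

Lemma erase_coord_inj x y :
  erase_coord x = erase_coord y -> x i0 = y i0 -> x = y.
Proof.
move=> /eqP/erase_coordP eqxy eq0; apply/ffunP => i.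
by have [->|/eqxy] := eqVneq i i0.
Qed.

(** This confines the image of [erase_coord] to the functions vanishing at [i0], so that the
    pigeonhole counts [q ^ (d - 1)] lines rather than [q ^ d] vertices. *)
Lemma erase_coord_pffun x :
  erase_coord x \in pffun_on 0%R (predC1 i0) (predT : pred 'Z_q).
Proof.
apply/pffun_onP; split=> //; apply/subsetP => i.
by rewrite !inE ffunE; case: (i == i0); rewrite ?eqxx.
Qed.

(** A point of a line is determined by its coordinate at [i0], which takes [q] values since
    [1 < q]. *)
Lemma card_line (A : {set hamming_vertex d q}) y :
  1 < q -> (forall x, x \in A -> erase_coord x = y) -> #|A| <= q.
Proof.
move=> q_gt1 Ay.
have inj0 : {in A &, injective (fun x : hamming_vertex d q => x i0)}.
  by move=> x x' /Ay ex /Ay ex'; apply: erase_coord_inj; rewrite ex ex'.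
by rewrite -(card_in_imset inj0) -[leqRHS](Zp_cast q_gt1) -[leqRHS]card_ord max_card.
Qed.

Lemma hamming_adjxx x : hamming_adj x x = false.
Proof.
rewrite /hamming_adj (_ : [set _ | _] = set0) ?cards0 //.
by apply/setP => i; rewrite !inE eqxx.
Qed.

Lemma hamming_adj_line x y :
  erase_coord x = erase_coord y -> x != y -> hamming_adj x y.
Proof.
move=> exy nxy; apply/cards1P; exists i0; apply/setP => i; rewrite !inE.
have [->|ni] := eqVneq i i0.
  by apply: contraNneq nxy => eq0; apply/eqP/erase_coord_inj.
by move/eqP/erase_coordP: exy => ->; rewrite ?eqxx.
Qed.

(** The only coordinate where adjacent vertices differ must then be [i0]. *)
Lemma hamming_adj_erase w x :
  hamming_adj w x -> w i0 != x i0 -> erase_coord w = erase_coord x.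
Proof.
move=> /cards1P[j /setP wx] n0; apply/eqP/erase_coordP => i ni.
have := wx i0; rewrite !inE n0 => /esym/eqP ej.
by have := wx i; rewrite !inE -ej (negbTE ni) => /negbFE/eqP.
Qed.

(** A neighbor of [x] off its line agrees with [x] at [i0], and likewise for [y]; being adjacent to
    both would force [x] and [y] to agree at [i0] and hence coincide. *)
Lemma off_line_adj w x y :
    erase_coord x = erase_coord y -> x != y -> erase_coord w != erase_coord x ->
  hamming_adj w x -> ~~ hamming_adj w y.
Proof.
move=> exy nxy nwx wx; apply/negP => wy.
have [w0x|/(hamming_adj_erase _ _ wx)/eqP] := eqVneq (w i0) (x i0); last exact/negP.
have [w0y|/(hamming_adj_erase _ _ wy)] := eqVneq (w i0) (y i0).
  by move/eqP: nxy; apply; apply: erase_coord_inj; rewrite -?w0x.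
by rewrite -exy => /eqP; apply/negP.
Qed.

Lemma vc_dim_line (U : {set hamming_vertex d q}) (a b c w : hamming_vertex d q) :
    [/\ a \in U, b \in U, c \in U & w \in U] ->
    erase_coord a = erase_coord c -> erase_coord b = erase_coord c ->
    [/\ a != b, c != a & c != b] ->
    ~~ hamming_adj w a -> ~~ hamming_adj w b ->
  2 <= vc_dim U (neighborhoods (@hamming_adj d q) U).
Proof.
move=> [aU bU cU wU] ea eb [nab nca ncb] nwa nwb.
(* No vertex is its own neighbor, so [b] realizes the trace [[set a]] and [a] realizes [[set b]]. *)
apply: (@vc_dim_ge2 _ _ _ a b w b a c); rewrite ?hamming_adjxx //; split=> //;
  by apply: hamming_adj_line; rewrite ?ea ?eb // eq_sym.
Qed.

End Line.

Theorem proposition1p1 (d q : nat) (hd : 2 <= d) (hq : 3 <= q)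
    (U : {set hamming_vertex d q}) (hU : 2 * q ^ (d - 1) + 1 <= #|U|) :
  2 <= vc_dim U (neighborhoods (@hamming_adj d q) U).
Proof.
pose i0 := Ordinal (ltnW hd); have q_gt1 := ltnW hq.
pose er := @erase_coord d q i0.
have [|y] := @exists_fiber_gt _ _ er U
  (pffun_on 0%R (predC1 i0) (predT : pred 'Z_q)) 2
  (fun x _ => erase_coord_pffun _ _ i0 x).
  (* The [d - 1] coordinates other than [i0] are free, which gives the exponent in [hU]. *)
  by rewrite card_pffun_on cardC1 !card_ord (Zp_cast q_gt1) -subn1 -addn1.
move=> /card_gt2P[a [b [c [[]]]]]; rewrite !inE.
move=> /andP[aU /eqP ea] /andP[bU /eqP eb] /andP[cU /eqP ec] [nab nbc nca].
(* Otherwise [U] lies on one line and [#|U| <= q <= q ^ (d - 1)], the last step by [2 <= d], against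
   [hU]. *)
have [w wU nw] : exists2 w, w \in U & er w != y.
  apply/exists_inP; apply: contraLR hU => /exists_inPn onL.
  have leU : #|U| <= q.
    by apply: (@card_line d q i0 U y q_gt1) => x /onL/negPn/eqP.
  rewrite -ltnNge addn1 ltnS (leq_trans leU) //.
  have le_q : q <= q ^ (d - 1) by rewrite -[leqLHS]expn1 leq_pexp2l ?subn_gt0 // ltnW.
  by rewrite (leq_trans le_q) // leq_pmull.
have off x x' : er x = y -> er x' = y -> x != x' ->
    hamming_adj w x -> ~~ hamming_adj w x'.
  move=> ex ex' nx; apply: (off_line_adj _ _ i0) => //; first by rewrite -/er ex ex'.
  by rewrite -/er ex.
(* If [w] is adjacent to [a] or to [b], that point becomes the one seeing both of the others; if to
   neither, [c] takes this role. *)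
have [wa|nwa] := boolP (hamming_adj w a).
  apply: (@vc_dim_line d q i0 U b c a w); rewrite -/er ?ea ?eb ?ec //.
  - by split=> //; rewrite eq_sym.
  - exact: off wa.
  - by apply: off wa => //; rewrite eq_sym.
have [wb|nwb] := boolP (hamming_adj w b).
  apply: (@vc_dim_line d q i0 U a c b w); rewrite -/er ?ea ?eb ?ec //.
  - by split=> //; rewrite eq_sym.
  - exact: off wb.
apply: (@vc_dim_line d q i0 U a b c w); rewrite -/er ?ea ?eb ?ec //.
by split=> //; rewrite eq_sym.
Qed.
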